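(* Let $n\ge 1$, let $\lambda$ be an $n$-partition, let $\sigma\in S_n^\lambda$, and let $T\in\mathcal{T}_\lambda$. Then $M(T)=Y_\lambda(\sigma)$ if and only if $T(l,k)\in G_\lambda(T,\sigma;l,k)$ for all $(l,k)\in\lambda$.
   Context: Notation. Fix $n\ge 1$. For integers $p,q$, $[p,q]=\{p,p+1,\dots,q\}$ (empty if $p>q$). An $n$-partition is $\lambda=(\lambda_1\ge\dots\ge\lambda_n\ge 0)$, integers. Its shape has $\lambda_i$ left-justified boxes in row $i$ (row 1 at the top). The box in column $j$ and row $i$ is written $(j,i)\in\lambda$ (column index first). The column lengths are $\zeta_1,\dots,\zeta_{\lambda_1}$. A semistandard tableau $T$ of shape $\lambda$ is a filling with values $T(j,i)\in[1,n]$ such that $T(j,i)\le T(j+1,i)$ and $T(j,i)<T(j,i+1)$; $\mathcal{T}_\lambda$ is the set of these. Boundary convention: the value $n+1$ is used whenever $T(j,i+1)$ is referenced with $i=\zeta_j$. Permutations and keys. $S_n$ is the set of $n$-tuples $\sigma=(\sigma_1,\dots,\sigma_n)$ with distinct entries from $[1,n]$. Let $q_1<\dots<q_r$ be the distinct column lengths of $\lambda$, $q_0:=0$, $q_{r+1}:=n$. $S_n^\lambda$ is the set of $\sigma\in S_n$ such that $\sigma_i<\sigma_j$ whenever $i<j$ both lie in $[q_{s-1}+1,q_s]$ for some $1\le s\le r+1$. The $\lambda$-key $Y=Y_\lambda(\sigma)$ is the tableau of shape $\lambda$ whose $j$th column consists of $\sigma_1,\dots,\sigma_{\zeta_j}$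 sorted increasingly from top to bottom, with entries $Y(j,i)$. Left scanning tableau. Given a semistandard tableau $X$ and a location $(l,k)$ of $X$, the maximizing weakly decreasing sequence (MWDS) from $(l,k)$ in $X$ starts with $X(l,k)$ and then successively, for columns $l-1,l-2,\dots,1$, takes the maximum value in that column of $X$ that is less than or equal to the most recent value taken; the locations of these values form a left scanning path. For $T\in\mathcal{T}_\lambda$ and $1\le l\le\lambda_1$, let $T^{(l,\zeta_l)}$ be $T$ with all columns to the right of column $l$ removed. For $k=\zeta_l,\zeta_l-1,\dots,1$: form in $T^{(l,k)}$ the MWDS from $(l,k)$, let $M(l,k)$ be its last value (in the first column), and obtain $T^{(l,k-1)}$ from $T^{(l,k)}$ by removing all locations in this path and all locations beneath them in their columns. The left scanning tableau $M(T)$ is the filling of $\lambda$ with value $M(l,k)$ at $(l,k)$. The sets $G$. For $l=1$, $G_\lambda(T,\sigma;1,k):=\{Y(1,k)\}$. For $l\ge 2$, let $V=V^{(l,k)}$ be $T^{(l,k)}$ with its rightmost remaining column (column $l$) removed. Let $q$ be maximal such that $(l-1,q)$ is a location of $V$ and $V(l-1,q)\le T(l,k+1)-1$. For $k\le h\le q$ form in $V$ the MWDS from $(l-1,h)$ (all within $V$, without removing any path as they are formed) and let $g_h$ be its final value, in the first column; one has $g_q\ge g_{q-1}\ge\cdots\ge g_k$. Let $p\ge k$ be minimal such that $g_p\ge Y(l,k)$. Among the values $g_q,\dots,g_p$, let $a$ be minimal and $b$ maximal such that $g_a=Y(l,k)=g_b$. If no such $a,b$ exist (in particular if no such $p$ exists),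 $G_\lambda(T,\sigma;l,k):=\emptyset$; otherwise $G_\lambda(T,\sigma;l,k):=[T(l-1,a),\,\min\{T(l-1,b+1)-1,\,T(l,k+1)-1\}]$.
   Formalization: In the upper end of G, the value T(l-1,b+1) is read in the remaining tableau V (n+1 if that box was removed); with the original T the claim fails for n=3, λ=(2,2,0), σ=(1,2,3), T with columns 12, 23. *)

(* Defs.v *)
From mathcomp Require Import all_boot.

Set Implicit Arguments.
Unset Strict Implicit.
Unset Printing Implicit Defensive.

(* All indices of the mathematical text (rows, columns, positions in a         *)
(* permutation) are 1-based; [nth] is 0-based, hence the [.-1].                *)

(* The integer interval [p, q], empty if p > q. *)
Definition itv (p q : nat) : seq nat := iota p (q.+1 - p).

Definition is_partition (n : nat) (lam : n.-tuple nat) : Prop := sorted geq lam.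

(* (j, i) is a box of the shape of lam: column j, row i. *)
Definition in_shape (lam : seq nat) (j i : nat) : bool :=
  (0 < i <= size lam) && (0 < j <= nth 0 lam i.-1).

(* The column lengths zeta_1, ..., zeta_(lam_1). *)
Definition zetas (lam : seq nat) : seq nat :=
  [seq count (leq j) lam | j <- itv 1 (nth 0 lam 0)].

(* Fillings of left- and top-justified shapes are lists of columns, each read  *)
(* from top to bottom.                                                         *)
Definition col (X : seq (seq nat)) (j : nat) : seq nat := nth [::] X j.-1.

(* X(j, i); the default n.+1 implements the convention T(j, zeta_j + 1) = n+1. *)
Definition entry (n : nat) (X : seq (seq nat)) (j i : nat) : nat :=
  nth n.+1 (col X j) i.-1.

Definition semistandard (n : nat) (lam : n.-tuple nat) (T : seq (seq nat)) : Prop :=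
  [/\ [seq size c | c <- T] = zetas lam,
      forall j i, in_shape lam j i -> 1 <= entry n T j i <= n,
      forall j i, in_shape lam j i -> in_shape lam j.+1 i ->
        entry n T j i <= entry n T j.+1 i
    & forall j i, in_shape lam j i -> in_shape lam j i.+1 ->
        entry n T j i < entry n T j i.+1].

Definition is_perm_tuple (n : nat) (sigma : n.-tuple nat) : Prop :=
  uniq sigma /\ {subset sigma <= itv 1 n}.

(* q_0 = 0, then the distinct column lengths q_1 < ... < q_r, then q_(r+1) = n. *)
Definition qs (n : nat) (lam : n.-tuple nat) : seq nat :=
  0 :: rcons (sort leq (undup (zetas lam))) n.

(* sigma belongs to S_n^lam. *)
Definition in_Snlam (n : nat) (lam sigma : n.-tuple nat) : Prop :=
  is_perm_tuple sigma /\
  forall s i j, 1 <= s < size (qs lam) ->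
    i \in itv (nth 0 (qs lam) s.-1).+1 (nth 0 (qs lam) s) ->
    j \in itv (nth 0 (qs lam) s.-1).+1 (nth 0 (qs lam) s) ->
    i < j -> nth 0 sigma i.-1 < nth 0 sigma j.-1.

Definition key (n : nat) (lam sigma : n.-tuple nat) : seq (seq nat) :=
  [seq sort leq (take z sigma) | z <- zetas lam].

(* The largest value of column c that is at most v (0 if there is none, which  *)
(* does not happen on a semistandard tableau).                                 *)
Definition max_below (v : nat) (c : seq nat) : nat := \max_(x <- c | x <= v) x.

(* The values of the MWDS from (l, k) in X, in columns l, l-1, ..., 1. *)
Definition mwds (n : nat) (X : seq (seq nat)) (l k : nat) : seq nat :=
  let v := entry n X l k in v :: scanl max_below v (rev (take l.-1 X)).

Definition mwds_end (n : nat) (X : seq (seq nat)) (l k : nat) : nat :=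
  last 0 (mwds n X l k).

(* X, having exactly l columns, with the left scanning path from (l, k) and    *)
(* everything beneath it removed. Columns have distinct entries, so [index]    *)
(* recovers the location of a value of the path in its column.                 *)
Definition remove_path (n : nat) (l k : nat) (X : seq (seq nat)) : seq (seq nat) :=
  [seq take (index cv.2 cv.1) cv.1 | cv <- zip X (rev (mwds n X l k))].

(* T^(l, k): columns 1, ..., l of T, after removing successively the paths     *)
(* from (l, zeta_l), (l, zeta_l - 1), ..., (l, k + 1).                         *)
Definition trunc (n : nat) (T : seq (seq nat)) (l k : nat) : seq (seq nat) :=
  foldr (remove_path n l) (take l T) (itv k.+1 (size (col T l))).

Definition left_scanning (n : nat) (T : seq (seq nat)) : seq (seq nat) :=
  [seq [seq mwds_end n (trunc n T l k) l k | k <- itv 1 (size (col T l))]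
     | l <- itv 1 (size T)].

(* The set G_lam(T, sigma; l, k), as an increasing list. In [G], the list      *)
(* [ab] holds, in increasing order, the h in [p, q] with g_h = Y(l, k); if p   *)
(* does not exist, its default value q.+1 makes [ab] empty. The bound at       *)
(* (l-1, b+1) is read in the truncated tableau V = T^(l, k) minus column l,    *)
(* i.e. it is n+1 if (l-1, b+1) is no longer a location of V. Reading it in T  *)
(* itself would break the characterization: for n = 3, lam = (2, 2, 0),        *)
(* sigma the identity and T with columns 12, 23, the left scanning tableau is  *)
(* the key but 2 = T(2, 1) would not lie in G(2, 1) = [1, 1].                  *)
Definition G (n : nat) (lam sigma : n.-tuple nat) (T : seq (seq nat))
    (l k : nat) : seq nat :=
  let y := entry n (key lam sigma) l k in
  if l <= 1 then [:: y] else
  let V := take l.-1 (trunc n T l k) in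
  let q := \max_(h <- itv 1 (size (col V l.-1))
                  | entry n V l.-1 h <= entry n T l k.+1 - 1) h in
  let g h := mwds_end n V l.-1 h in
  let p := head q.+1 [seq h <- itv k q | y <= g h] in
  let ab := [seq h <- itv p q | g h == y] in
  if ab is a :: s then
    let b := last a s in
    itv (entry n T l.-1 a)
        (minn (entry n V l.-1 b.+1 - 1) (entry n T l k.+1 - 1))
  else [::].

(* Main.v *)
Require Import Defs.
From mathcomp Require Import all_boot.
From mathcomp Require Import zify.

(* The equivalence holds box by box, whatever the value y = Y(l, k) is. None of *)
(* the paths removed before (l, k) meets the first k rows of columns l - 1 and  *)
(* l, so the second location of the path from (l, k) is a location (l - 1, h)   *)
(* of V with k <= h <= q, characterized by V(l-1, h) <= T(l, k) < V(l-1, h+1),  *)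
(* and then M(l, k) = g_h. As g is nondecreasing, g_h = y if and only if        *)
(* a <= h <= b, which is the condition T(l, k) \in G(l, k).                     *)

(** Only two columns of the truncated tableau matter. Rows of [T] weakly increase, so a path
    starting in row k' of column l meets column l - 1 in row k' or lower. Removing the paths for all
    k' > k therefore leaves prefixes of columns l - 1 and l of [T] with at least k rows
    ([trunc_prefix]), and the path from (l, k) still finds its next location in some row h >= k
    ([mwds_step]). The rest is one-dimensional: [mem_interval_G] turns g_h = y into interval
    membership, [mwds_end_G] applies this at one box, and [left_scanning_eq_key] splits equality of
    the two fillings into boxes. *)

Lemma mem_itv p q x : (x \in itv p q) = (p <= x <= q).
Proof. by rewrite mem_iota; lia. Qed.

Lemma sorted_itv p q : sorted leq (itv p q).
Proof. exact: iota_sorted. Qed.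

Lemma size_itv1 q : size (itv 1 q) = q.
Proof. by rewrite size_iota subn1. Qed.

Lemma nth_itv1 d q i : i < q -> nth d (itv 1 q) i = i.+1.
Proof. by move=> iq; rewrite nth_iota ?subn1. Qed.

Lemma sorted_leq_head d s x : sorted leq s -> x \in s -> head d s <= x.
Proof.
case: s => // a s /= /(order_path_min leq_trans)/allP as_.
by rewrite inE => /predU1P[->|/as_].
Qed.

Lemma sorted_leq_last d s x : sorted leq s -> x \in s -> x <= last d s.
Proof.
elim/last_ind: s => // s b _; rewrite last_rcons mem_rcons inE.
move=> /= sb /predU1P[->//|xs].
have := sorted_leq_nth leq_trans leqnn 0 sb (index x s) (size s).
rewrite !inE size_rcons !nth_rcons index_mem xs nth_index // ltnn eqxx.
by apply=> //; rewrite ?ltnS ?index_size.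
Qed.

(** * The greatest entry of a column not exceeding a bound *)

Lemma max_below_mono c : {homo max_below^~ c : v w / v <= w}.
Proof.
move=> v w vw; apply/bigmax_leqP_seq => x xc xv.
by apply: leq_bigmax_seq => //; apply: leq_trans vw.
Qed.

Lemma foldl_max_below_mono s : {homo (foldl max_below)^~ s : v w / v <= w}.
Proof. by elim: s => //= c s IH v w vw; apply/IH/max_below_mono. Qed.

(** The [has] hypothesis excludes the empty maximum 0, which need not be an entry of [c]. *)
Lemma max_below_mem v c : has (leq^~ v) c -> max_below v c \in c.
Proof.
rewrite /max_below; elim: c => //= x c IH; rewrite big_cons.
have [hc _|/hasPn hc] := boolP (has _ c).
  have := IH hc; set m := (\max_(x <- c | _) _); rewrite inE.
  case: ifP => [_ mc|_ ->]; last by rewrite orbT.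
  by case: (leqP x m); rewrite ?eqxx ?mc ?orbT.
rewrite orbF => ->; rewrite big_seq_cond big_pred0 ?maxn0 ?mem_head // => y.
by apply/negP => /andP[/hc/negP].
Qed.

Lemma max_below_nth d v c i :
    sorted ltn c -> i < size c -> nth d c i <= v ->
  exists j, [/\ i <= j < size c, max_below v c = nth d c j, nth d c j <= v
    & j.+1 < size c -> v < nth d c j.+1].
Proof.
move=> sc ic civ.
have mc : max_below v c \in c.
  by apply: max_below_mem; apply/hasP; exists (nth d c i); rewrite ?mem_nth.
have mono := sorted_ltn_nth ltn_trans d sc.
have jc : index (max_below v c) c < size c by rewrite index_mem.
have cj := nth_index d mc.
set j := index _ _ in jc cj; exists j; rewrite cj; split=> //.
- rewrite jc andbT leqNgt; apply/negP => ji.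
  have := mono j i jc ic ji; rewrite cj ltnNge.
  by rewrite (leq_bigmax_seq (nth d c i)) ?mem_nth.
- by apply/bigmax_leqP_seq.
- move=> j1; rewrite ltnNge; apply/negP => jv.
  have := mono j j.+1 jc j1 (ltnSn _); rewrite cj ltnNge.
  by rewrite (leq_bigmax_seq (nth d c j.+1)) ?mem_nth.
Qed.

(** * Scanning paths and their removal *)

Lemma mwds_endE n X l k :
  mwds_end n X l k = foldl max_below (entry n X l k) (rev (take l.-1 X)).
Proof.
rewrite /mwds_end /mwds -nth_last /= size_scanl.
by rewrite nth_cons_scanl // take_size.
Qed.

(** Each step of a path is monotone in the previous value; this is what makes g_h nondecreasing in
    h. *)
Lemma mwds_end_mono n X l i j :
  entry n X l i <= entry n X l j -> mwds_end n X l i <= mwds_end n X l j.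
Proof. by rewrite !mwds_endE; apply: foldl_max_below_mono. Qed.

Lemma rev_take_col X l : 0 < l <= size X ->
  rev (take l X) = col X l :: rev (take l.-1 X).
Proof. by case: l => // l lX; rewrite (take_nth [::]) // rev_rcons. Qed.

Lemma size_mwds n X l k : 0 < l <= size X -> size (mwds n X l k) = l.
Proof. move=> h; rewrite /= size_scanl size_rev size_take; case: ltnP; lia. Qed.

Lemma size_remove_path n l k X : 0 < l -> size X = l ->
  size (remove_path n l k X) = l.
Proof.
move=> l0 Xl.
by rewrite size_map size_zip size_rev size_mwds ?Xl ?minnn ?l0 /=.
Qed.

(** A path is listed from column l leftwards, so column j is cut at the value in position l - j. *)
Lemma col_remove_path n l k X j : 0 < j <= l -> size X = l ->
  col (remove_path n l k X) j =
  take (index (nth 0 (mwds n X l k) (l - j)) (col X j)) (col X j).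
Proof.
move=> jl Xl; have sm : size (mwds n X l k) = l by rewrite size_mwds; lia.
rewrite /col /remove_path (nth_map ([::], 0)); last first.
  by rewrite size_zip size_rev sm Xl minnn; lia.
rewrite nth_zip ?size_rev ?sm //= nth_rev sm; last by lia.
by congr (take (index (nth _ _ _) _) _); lia.
Qed.

(** The counts are the parts of the conjugate partition; 0 < l makes the default part 0 behave like
    an absent row. *)
Lemma leq_count_leq (s : seq nat) l i : 0 < l -> sorted geq s ->
  (l <= nth 0 s i) = (i < count (leq l) s).
Proof.
move=> l0; elim: s i => [|x s IH] i xs; first by rewrite nth_nil leqNgt l0.
have ss := path_sorted xs.
have /allP sx : all (geq x) s.
  by apply: order_path_min xs => a b c /= ba ac; apply: leq_trans ba.
case: (leqP l x) => lx.
  by case: i => [|i] /=; rewrite lx ?ltnS ?IH.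
have s0 : count (leq l) s = 0.
  by apply/eqP; rewrite -leqn0 leqNgt -has_count; apply/hasPn => y /sx /=; lia.
have lxF : (l <= x) = false by rewrite leqNgt lx.
by rewrite /= s0 lxF; case: i => [|i] /=; rewrite ?lxF // IH // s0.
Qed.

Lemma in_shapeE (lam : seq nat) l k : sorted geq lam ->
  in_shape lam l k = (0 < l) && (0 < k <= count (leq l) lam).
Proof.
rewrite /in_shape => slam; case: l => [|l]; first by rewrite /= andbF.
case: k => [|k] //=.
rewrite leq_count_leq // andb_idl // => /leq_trans; apply; exact: count_size.
Qed.

(* The interval defining G detects the row h reached by the path in column     *)
(* l - 1: [f] and [f'] stand for the columns l - 1 of V and T, [t] for T(l, k) *)
(* and [B] for T(l, k + 1).                                                    *)
Lemma mem_interval_G (f f' g : nat -> nat) s k h t B y :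
    (forall i j, 0 < i -> i < j -> j <= s.+1 -> f i < f j) ->
    (forall i, i <= s -> f' i = f i) ->
    (forall i j, i <= j -> j <= s -> g i <= g j) ->
    0 < k <= h -> h <= s -> f h <= t < f h.+1 -> 0 < t < B ->
  let q := \max_(i <- itv 1 s | f i <= B - 1) i in
  let p := head q.+1 [seq i <- itv k q | y <= g i] in
  let ab := [seq i <- itv p q | g i == y] in
  g h = y <-> t \in if ab is a :: r then
                      itv (f' a) (minn (f (last a r).+1 - 1) (B - 1))
                    else [::].
Proof.
move=> fS f'E gS /andP[k0 kh] hs /andP[fht tfh] /andP[t0 tB] q p ab.
have hq : h <= q by apply: leq_bigmax_seq; rewrite ?mem_itv; lia.
have qs : q <= s by apply/bigmax_leqP_seq => i; rewrite mem_itv; lia.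
have sab : sorted leq ab by rewrite sorted_filter ?sorted_itv //; apply: leq_trans.
have mab i : i \in ab = (g i == y) && (p <= i <= q) by rewrite mem_filter mem_itv.
split=> [ghy|].
  have hab : h \in ab.
    rewrite mab ghy eqxx hq andbT /=; apply: sorted_leq_head.
      by rewrite sorted_filter ?sorted_itv //; apply: leq_trans.
    by rewrite mem_filter mem_itv ghy leqnn kh.
  case: (ab) sab hab mab => // a r sar har mar.
  have ah : a <= h := sorted_leq_head 0 _ _ sar har.
  have hb : h <= last a r := sorted_leq_last 0 _ _ sar har.
  have /andP[_ /andP[_ aq]] : (g a == y) && (p <= a <= q) by rewrite -mar mem_head.
  have /andP[_ /andP[pb bq]] : (g (last a r) == y) && (p <= last a r <= q).
    by rewrite -mar mem_last.
  (* Either [p] is the default [q.+1] or it lies in [k, q]. Hence [a] is positive, as needed because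
     [f] is increasing only from row 1 on. *)
  have pk : k <= p.
    have : p \in q.+1 :: [seq i <- itv k q | y <= g i].
      by rewrite /p; case: filter => [|z z']; rewrite ?inE /= ?eqxx ?orbT.
    by rewrite inE mem_filter mem_itv; lia.
  have pa : p <= a.
    by have := mar a; rewrite mem_head => /esym/andP[_ /andP[]].
  rewrite mem_itv f'E; last by lia.
  have fah : f a <= f h.
    case: (ltngtP a h) ah => [ah _|//|-> //]; apply/ltnW/fS; lia.
  have fhb : f h.+1 <= f (last a r).+1.
    case: (ltngtP h (last a r)) hb => [hb _|//|<- //]; apply/ltnW/fS; lia.
  rewrite leq_min; lia.
case: (ab) sab mab => // a r sar mar.
have /andP[/eqP gay /andP[_ aq]] : (g a == y) && (p <= a <= q).
  by rewrite -mar mem_head.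
have /andP[/eqP gby /andP[_ bq]] : (g (last a r) == y) && (p <= last a r <= q).
  by rewrite -mar mem_last.
rewrite mem_itv leq_min f'E; last by lia.
move=> /and3P[fat tfb _].
have ah : a <= h.
  rewrite leqNgt; apply/negP => ha.
  have : f h.+1 <= f a.
    case: (ltngtP h.+1 a) ha => [ha _|//|-> //]; apply/ltnW/fS; lia.
  lia.
have hb : h <= last a r.
  rewrite leqNgt; apply/negP => bh.
  have : f (last a r).+1 <= f h.
    case: (ltngtP (last a r).+1 h) bh => [bh _|//|-> //]; apply/ltnW/fS; lia.
  lia.
(* Now a <= h <= b, so g_h is squeezed between two values equal to y. *)
have := gS a h ah hs; have := gS h (last a r) hb; lia.
Qed.

(** * Semistandard tableaux and their truncations *)

Section Semistandard.

Variables (n : nat) (lam sigma : n.-tuple nat) (T : seq (seq nat)).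
Hypotheses (hlam : is_partition lam) (hT : semistandard lam T).

Let zeta l := count (leq l) lam.

Lemma size_zetas : size (zetas lam) = nth 0 lam 0.
Proof. by rewrite size_map size_itv1. Qed.

Lemma nth_zetas l : l < nth 0 lam 0 -> nth 0 (zetas lam) l = zeta l.+1.
Proof. by move=> h; rewrite (nth_map 0) ?size_itv1 // nth_itv1. Qed.

Lemma size_tableau : size T = nth 0 lam 0.
Proof. by case: hT => h _ _ _; rewrite -size_zetas -h size_map. Qed.

Lemma in_shape_col l k : in_shape lam l k = (0 < l) && (0 < k <= zeta l).
Proof. exact: in_shapeE. Qed.

Lemma in_shape_le l k : in_shape lam l k -> 0 < l <= nth 0 lam 0.
Proof.
rewrite in_shape_col => /and3P[l0 k0 kz]; rewrite l0 leq_count_leq //.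
exact: leq_trans k0 kz.
Qed.

Lemma size_col l : 0 < l <= nth 0 lam 0 -> size (col T l) = zeta l.
Proof.
case: l => // l lT; rewrite /col /= -nth_zetas //.
by case: hT => <- _ _ _; rewrite (nth_map [::]) // size_tableau.
Qed.

Lemma zeta_mono l : zeta l.+1 <= zeta l.
Proof. by apply: sub_count => x; apply: ltnW. Qed.

Lemma entry_bounds l k : in_shape lam l k -> 0 < entry n T l k <= n.
Proof. by case: hT => _ h _ _; apply: h. Qed.

Lemma entry_row l k : 0 < l -> in_shape lam l.+1 k ->
  entry n T l k <= entry n T l.+1 k.
Proof.
move=> l0; case: hT => _ _ h _ s; apply: h => //.
by move: s (zeta_mono l); rewrite !in_shape_col l0; lia.
Qed.

(** At the bottom of a column the convention n+1 supplies the entry below. *)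
Lemma entry_col_lt l k : in_shape lam l k -> entry n T l k < entry n T l k.+1.
Proof.
move=> s; have := s; rewrite in_shape_col => /and3P[l0 k0 kz].
have lT := in_shape_le l k s.
case: (ltnP k (zeta l)) => h.
  by case: hT => _ _ _ ht; apply: ht; rewrite ?in_shape_col; lia.
have /andP[_ tn] := entry_bounds l k s.
by rewrite [X in _ < X]nth_default // size_col.
Qed.

Lemma sorted_col l : 0 < l <= nth 0 lam 0 -> sorted ltn (col T l).
Proof.
move=> lT; apply/(sortedP n.+1) => i; rewrite size_col // => iz.
by apply: (entry_col_lt l i.+1); rewrite in_shape_col; lia.
Qed.

Lemma truncS l k : k < size (col T l) ->
  trunc n T l k = remove_path n l k.+1 (trunc n T l k.+1).
Proof.
move=> h; rewrite /trunc /itv subSS.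
by rewrite (_ : size (col T l) - k = (size (col T l) - k.+1).+1) //; lia.
Qed.

Lemma entry_take X j r i : col X j = take r (col T j) -> i.-1 < r ->
  entry n X j i = entry n T j i.
Proof. by move=> h ir; rewrite /entry h nth_take. Qed.

(** Row k of column l survives in [X] and is at most T(l+1, k), so the greatest admissible entry is
    in row k or below. If it is the last remaining one, the next entry reads as n+1. *)
Lemma mwds_step X l k r : in_shape lam l.+1 k -> 0 < l -> k <= r ->
    col X l = take r (col T l) ->
  exists j, [/\ k <= j <= size (col X l),
    max_below (entry n T l.+1 k) (col X l) = entry n X l j,
    entry n X l j <= entry n T l.+1 k < entry n X l j.+1
  & index (entry n X l j) (col X l) = j.-1].
Proof.
move=> s l0 kr Xl; have := s; rewrite in_shape_col => /= /andP[k0 kz].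
have lT : 0 < l <= nth 0 lam 0 by have := in_shape_le _ _ s; lia.
have sX : sorted ltn (col X l) by rewrite Xl take_sorted // sorted_col.
have kX : k <= size (col X l).
  by rewrite Xl size_take size_col //; have := zeta_mono l; case: ltnP; lia.
have kt : entry n X l k <= entry n T l.+1 k.
  by rewrite (entry_take X l r k Xl) ?entry_row //; lia.
have [|j [/andP[kj jX] mj jt jt']] := max_below_nth _ _ _ k.-1 sX _ kt; first by lia.
exists j.+1; split; rewrite /entry /=.
- lia.
- exact: mj.
- rewrite -/(entry n T l.+1 k) jt /=.
  case: (ltnP j.+1 (size (col X l))) => [/jt' //|jd].
  by rewrite nth_default //; have := entry_bounds _ _ s; lia.
- by apply: index_uniq; rewrite // (sorted_uniq ltn_trans ltnn).
Qed.

Lemma trunc_prefix l k : 0 < l <= nth 0 lam 0 -> k <= zeta l ->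
  size (trunc n T l k) = l /\
  forall j, 0 < j <= l -> l <= j.+1 ->
    exists2 r, k <= r & col (trunc n T l k) j = take r (col T j).
Proof.
move=> lT; have [m] := ubnP (zeta l - k).
(* Induction on the number of paths already removed. *)
elim: m k => // m IH k mk kz.
have [kz'|kz'] := ltnP k (zeta l); last first.
  have -> : trunc n T l k = take l T.
    by rewrite /trunc /itv size_col // (_ : _ - _ = 0) //; lia.
  split; first by rewrite size_takel // size_tableau; lia.
  move=> j jl lj; exists (zeta j).
    apply: leq_trans kz _; have := zeta_mono j.
    by have [->|->] : l = j \/ l = j.+1 by lia.
  rewrite -size_col ?take_size; last by lia.
  by rewrite /col nth_take //; lia.
have [Xl XT] := IH k.+1 ltac:(lia) kz'.
rewrite truncS ?size_col //; split; first by apply: size_remove_path => //; lia.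
move=> j jl lj; rewrite col_remove_path //.
set X := trunc n T l k.+1 in Xl XT *. clearbody X.
have [rl kr Xrl] := XT l ltac:(lia) ltac:(lia).
have s : in_shape lam l k.+1 by rewrite in_shape_col; lia.
have el : entry n X l k.+1 = entry n T l k.+1 by apply: entry_take Xrl _.
have [r kr' Xr] := XT j jl lj.
have take2 i : k <= i ->
    exists2 r, k <= r & take i (col X j) = take r (col T j).
  move=> ki; exists (minn i r); first by lia.
  by rewrite Xr take_min.
apply: take2.
have [ej|ej] : j = l \/ l = j.+1 by lia.
  (* In column l the path removed starts in row k+1, so the cut leaves exactly k rows. *)
  subst j; rewrite subnn /=.
  have kX : k < size (col X l).
    by rewrite Xr size_take size_col //; case: (ltnP r); lia.
  rewrite /entry /= index_uniq // (sorted_uniq ltn_trans ltnn) //.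
  by rewrite Xr take_sorted // sorted_col.
(* In column l - 1 the path meets a row i >= k+1, so at least k rows remain above it. *)
rewrite ej in Xl s el *; rewrite subSn // subnn /=.
have j0 : 0 < j by lia.
rewrite rev_take_col /=; last by rewrite Xl; lia.
have [i [ki mi _ ind]] := mwds_step X j k.+1 r s j0 kr' Xr.
by rewrite el mi ind; lia.
Qed.

Lemma mwds_end_G l k : in_shape lam l k ->
  mwds_end n (trunc n T l k) l k = entry n (key lam sigma) l k <->
  entry n T l k \in G lam sigma T l k.
Proof.
move=> s; have := s; rewrite in_shape_col => /and3P[l0 k0 kz].
have lT := in_shape_le _ _ s.
have [Xl XT] := trunc_prefix l k lT kz.
rewrite /G; set y := entry n (key _ _) l k; set X := trunc n T l k in Xl XT *; clearbody X.
have el : entry n X l k = entry n T l k.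
  by have [r kr Xr] := XT l ltac:(lia) ltac:(lia); apply: entry_take Xr _; lia.
rewrite mwds_endE el; case: leqP => l1.
  have -> : l = 1 by lia.
  by rewrite take0 mem_seq1; split=> /eqP.
clearbody y; case: l l0 l1 s kz lT Xl XT el => // l _ l1 s kz lT Xl XT el.
rewrite -[l.+1.-1]/l rev_take_col /=; last by rewrite Xl; lia.
have [r kr Xr] := XT l ltac:(lia) ltac:(lia).
have lT' : 0 < l <= nth 0 lam 0 by lia.
have [h [hk mh hh _]] := mwds_step X l k r s l1 kr Xr.
set V := take l X.
have VX : col V l = col X l by rewrite /col nth_take //; lia.
have entV i : entry n V l i = entry n X l i by rewrite /entry VX.
(* After its first step the path is the MWDS of [V] from (l, h), so its end is g_h. *)
have -> : foldl max_below (max_below (entry n T l.+1 k) (col X l))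
    (rev (take l.-1 X)) = mwds_end n V l h.
  by rewrite mwds_endE mh entV take_takel //; lia.
have VE i : 0 < i <= size (col V l) -> entry n V l i = entry n T l i.
  rewrite VX entV Xr size_take => ir; apply: entry_take Xr _.
  by move: ir; case: (ltnP r); lia.
have sV : size (col V l) <= zeta l.
  by rewrite VX Xr size_take size_col //; case: ltnP; lia.
have ltV i j : 0 < i -> i < j -> j <= (size (col V l)).+1 ->
    entry n V l i < entry n V l j.
  move=> i0 ij; rewrite leq_eqVlt => /predU1P[ej|jV].
    rewrite ej in ij *.
    rewrite [X in _ < X]nth_default // VE; last by lia.
    by have := entry_bounds l i; rewrite in_shape_col => /(_ ltac:(lia)); lia.
  rewrite !VE; try lia.
  have := sorted_ltn_nth ltn_trans n.+1 (sorted_col _ lT').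
  by apply; rewrite ?inE ?size_col //; lia.
have V0 : 0 < size (col V l) by rewrite VX; lia.
have tb := entry_bounds _ _ s.
apply: (mem_interval_G (entry n V l) (entry n T l) (mwds_end n V l)
          (size (col V l)) k) => //.
- by case=> [|i] iV; [apply/esym/(VE 1); lia | rewrite VE].
- move=> i j ij js; apply: mwds_end_mono.
  (* Row 0 reads the same entry as row 1, because [.-1] sends both to index 0. *)
  case: i ij => [|i] ij; last first.
    by move: ij; rewrite leq_eqVlt => /predU1P[->//|ij]; apply/ltnW/ltV; lia.
  case: j ij js => [|[|j]] _ js //.
  by apply/ltnW/(ltV 1); lia.
- lia.
- by rewrite VX; lia.
- by rewrite !entV.
- by have := entry_col_lt _ _ s; lia.
Qed.

(** * From equality of fillings to equality box by box *)

Lemma size_col_key l : 0 < l <= nth 0 lam 0 ->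
  size (nth [::] (key lam sigma) l.-1) = zeta l.
Proof.
case: l => // l lT; rewrite /key (nth_map 0) ?size_zetas // size_sort.
(* A column has at most n boxes, so [take] never runs past the end of [sigma]. *)
rewrite nth_zetas // size_takel // size_tuple -[X in _ <= X](size_tuple lam).
exact: count_size.
Qed.

Lemma nth_left_scanning l : l < nth 0 lam 0 ->
  nth [::] (left_scanning n T) l =
  [seq mwds_end n (trunc n T l.+1 k) l.+1 k | k <- itv 1 (zeta l.+1)].
Proof.
move=> h; rewrite /left_scanning (nth_map 0) ?size_itv1 ?size_tableau //.
by rewrite nth_itv1 // size_col.
Qed.

Lemma left_scanning_eq_key :
  left_scanning n T = key lam sigma <->
  forall l k, in_shape lam l k ->
    mwds_end n (trunc n T l k) l k = entry n (key lam sigma) l k.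
Proof.
split=> [E l k s|E].
  have := in_shape_le _ _ s; move: s; rewrite in_shape_col /entry /col -E.
  case: l k => [|l] [|k] //= kz lT.
  by rewrite nth_left_scanning // (nth_map 0) ?size_itv1 // nth_itv1.
apply: (@eq_from_nth _ [::]).
  by rewrite !size_map size_itv1 size_tableau size_itv1.
move=> l; rewrite size_map size_itv1 size_tableau => lT.
have sz := size_col_key l.+1 lT; rewrite nth_left_scanning //.
apply: (@eq_from_nth _ n.+1); first by rewrite size_map size_itv1 sz.
move=> k; rewrite size_map size_itv1 => kz.
rewrite (nth_map 0) ?size_itv1 // nth_itv1 // E //.
by rewrite in_shape_col kz.
Qed.

End Semistandard.

Theorem theorem9p2 (n : nat) (lam sigma : n.-tuple nat) (T : seq (seq nat))
  (hn : 1 <= n) (hlam : is_partition lam) (hsigma : in_Snlam lam sigma)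
  (hT : semistandard lam T) :
  left_scanning n T = key lam sigma <->
  (forall l k, in_shape lam l k -> entry n T l k \in G lam sigma T l k).
Proof.
rewrite left_scanning_eq_key //.
by split=> h l k s; apply/(mwds_end_G _ lam) => //; apply: h.
Qed.
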